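(* Fix $d\geq 1$ and any positive increasing function $r$ on $[1,\infty)$ such that $$\liminf_{t\to\infty}\frac{\ln r(t)}{\ln\ln\ln t} > 1.$$ There is a constant $c>0$ depending only on $r$ and $d$ such that the following is true. Suppose that $\mathbb{R}^d$ is tiled by a family $\mathcal{B}$ of nonoverlapping closed, isotropic boxes $B$, each with side length $\ell(B)\geq 1$. If any two adjacent boxes $B_1,B_2\in\mathcal{B}$ (i.e., boxes having common boundary points) satisfy $$\max\{\ell(B_1),\ell(B_2)\} \leq \min\{\ell(B_1),\ell(B_2)\}\left[1+\frac{1}{r(\max\{\ell(B_1),\ell(B_2)\})}\right],$$ then any collection $\mathcal{T}_*$ of tiles whose tile sets are exactly the sets $(1+2c)B$ for $B\in\mathcal{B}$ must be an admissible tiling of $\mathbb{R}^d$ with respect to $(\mathcal{C},\theta,K)$ for some choice of $(\mathcal{C},\theta,K)$ which depends only on $r$ and $d$.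
   Context: $|\cdot|$ denotes the $\ell^\infty$ norm on $\mathbb{R}^d$, and on matrices the operator norm $\ell^\infty\to\ell^\infty$. An isotropic box is an axis-parallel cube (a product of $d$ intervals of the same length $\ell(B)$); ''tiled by nonoverlapping boxes'' means the boxes cover $\mathbb{R}^d$ and have pairwise disjoint interiors. $(1+2c)B$ denotes the dilation of $B$ by the factor $1+2c$ about its center. Tiles. A tile is a pair $T=(D,\xi)\in GL_d(\mathbb{R})\times\mathbb{R}^d$. Its tile set is $T_\square:=\{\eta\in\mathbb{R}^d:|D^{-1}(\eta-\xi)|\leq\tfrac12\}$. For $t>0$, $tT:=(tD,\xi)$, and $\dot T:=(D,0)$. Distance. For tiles $T_i=(D_i,\xi_i)$, $d(T_1,T_2):=\log_2\max\{|D_1^{-1}D_2|,|D_2^{-1}D_1|\}$. This depends only on the origin-centered tile sets $(\dot T_1)_\square,(\dot T_2)_\square$, and gives a metric on the space of origin-centered tile sets (the tile sets of tiles of the form $(D,0)$). Admissible tilings. Given $\mathcal{C}>1$, $\theta\in(0,1)$ and a nondecreasing function $K$ on $[1,\infty)$ with $K(1)\geq1$ and $\int_1^\infty\frac{\ln K(t)}{t^2}dt<\infty$, a collection of tiles $\mathcal{T}_*$ is an admissible tiling of $\mathbb{R}^d$ with respect to $(\mathcal{C},\theta,K)$ when: (1) (Covering) Almost every $\xi\in\mathbb{R}^d$ belongs to $((1-\theta)T)_\square$ for some $T\in\mathcal{T}_*$ and does not belong to $T_\square$ for more than $\mathcal{C}$ distinct tiles $T\in\mathcal{T}_*$. (2)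 (Regularity) There exists a function $\rho:\mathcal{T}_*\to[1,\infty)$ such that (a) if $T_1,T_2\in\mathcal{T}_*$ and the tile sets of $T_2$ and $\rho(T_1)T_1$ intersect, then $d(\dot T_1,\dot T_2)\leq\mathcal{C}$; and (b) for each $t\geq1$, the set $\{\dot T_\square:T\in\mathcal{T}_*,\ \rho(T)\leq t\}$ can be covered by no more than $K(t)$ metric balls of radius $\mathcal{C}$ (in the space of origin-centered tile sets with metric $d$). *)

(* Defs.v *)
From HB Require Import structures.
From mathcomp Require Import all_boot all_order all_algebra.
From mathcomp Require Import all_classical all_reals all_analysis.

Set Implicit Arguments.
Unset Strict Implicit.
Unset Printing Implicit Defensive.

Import Order.TTheory GRing.Theory Num.Theory.
Import numFieldNormedType.Exports.

Local Open Scope classical_set_scope.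
Local Open Scope ring_scope.
Local Open Scope card_scope.

(* Points of R^d are column vectors; the library norm `|x| on 'cV[R]_d is
   the l^oo norm. *)

Section OperatorNorm.
Context {R : realType} {d : nat}.

(* The library norm `|A| of a square matrix is its largest entry, which is not
   the operator norm. *)
Definition op_norm (A : 'M[R]_d) : R :=
  sup [set `|A *m x| | x in [set x : 'cV[R]_d | `|x| <= 1]].

End OperatorNorm.

Section LebesgueNull.
Context {R : realType} {d : nat}.

Definition rectangle (a b : 'cV[R]_d) : set 'cV[R]_d :=
  [set x | forall i, x i 0 \in `[a i 0, b i 0]].

(* The library has no Lebesgue measure on R^d, hence this outer measure. *)
Definition lebesgue_outer (A : set 'cV[R]_d) : \bar R :=
  ereal_inf [set s | exists a b : nat -> 'cV[R]_d,
    [/\ forall k i, a k i 0 <= b k i 0,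
        A `<=` \bigcup_k rectangle (a k) (b k) &
        s = (\sum_(0 <= k <oo) (\prod_i (b k i 0 - a k i 0))%:E)%E]].

Definition almost_every (P : 'cV[R]_d -> Prop) : Prop :=
  lebesgue_outer [set x | ~ P x] = 0%E.

End LebesgueNull.

Section Tiles.
Context {R : realType} {d : nat}.

(* A pair (D, xi) of this type is a tile when D is invertible (is_tile). *)
Definition tile : Type := ('M[R]_d * 'cV[R]_d)%type.

Definition is_tile (T : tile) : Prop := T.1 \in unitmx.

Definition tile_set (T : tile) : set 'cV[R]_d :=
  [set eta | `|invmx T.1 *m (eta - T.2)| <= 2^-1].

Definition tile_scale (t : R) (T : tile) : tile := (t *: T.1, T.2).

Definition tile_dot (T : tile) : tile := (T.1, 0).

Definition tile_dist (T1 T2 : tile) : R :=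
  ln (Num.max (op_norm (invmx T1.1 *m T2.1)) (op_norm (invmx T2.1 *m T1.1)))
    / ln 2.

(* tile_dist descends to origin-centered tile sets; this is the open ball of
   radius C about tile_set (D, 0) in the space of such sets. *)
Definition centered_ball (D : 'M[R]_d) (C : R) : set (set 'cV[R]_d) :=
  [set tile_set (D', 0) | D' in
    [set D' : 'M[R]_d | D' \in unitmx /\ tile_dist (D, 0) (D', 0) < C]].

Definition covered_by_balls (n : nat) (C : R) (S : set (set 'cV[R]_d)) : Prop :=
  exists D : 'I_n -> 'M[R]_d, (forall i, D i \in unitmx) /\
    S `<=` \bigcup_i centered_ball (D i) C.

End Tiles.

Arguments tile : clear implicits.

Section AdmissibleTiling.
Context {R : realType} {d : nat}.

Definition nondecreasing_from1 (f : R -> R) : Prop :=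
  {in `[1, +oo[ &, {homo f : x y / x <= y}}.

Definition admissible_parameters (C theta : R) (K : R -> R) : Prop :=
  [/\ 1 < C,
      0 < theta < 1,
      nondecreasing_from1 K,
      1 <= K 1 &
      (\int[lebesgue_measure]_(t in `[1%R, +oo[) (ln (K t) / t ^+ 2)%:E
        < +oo)%E].

Definition covering_condition (C theta : R) (Ts : set (tile R d)) : Prop :=
  almost_every (fun xi : 'cV[R]_d =>
    (exists2 T, Ts T & tile_set (tile_scale (1 - theta) T) xi) /\
    (exists2 n : nat, n%:R <= C &
       [set T | Ts T /\ tile_set T xi] #<= `I_n)).

Definition regularity_condition (C : R) (K : R -> R) (Ts : set (tile R d)) :
    Prop :=
  exists rho : tile R d -> R,
    [/\ forall T, Ts T -> 1 <= rho T,
        forall T1 T2, Ts T1 -> Ts T2 ->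
          tile_set T2 `&` tile_set (tile_scale (rho T1) T1) !=set0 ->
          tile_dist (tile_dot T1) (tile_dot T2) <= C &
        forall t, 1 <= t ->
          exists2 n : nat, n%:R <= K t &
            covered_by_balls n C
              [set tile_set (tile_dot T) | T in [set T | Ts T /\ rho T <= t]]].

Definition admissible_tiling (C theta : R) (K : R -> R) (Ts : set (tile R d)) :
    Prop :=
  [/\ forall T, Ts T -> is_tile T,
      covering_condition C theta Ts &
      regularity_condition C K Ts].

End AdmissibleTiling.

Section Boxes.
Context {R : realType} {d : nat}.

Record box : Type := Box { box_center : 'cV[R]_d; box_side : R }.

Definition box_set (B : box) : set 'cV[R]_d :=
  [set x | forall i, x i 0 \in `[box_center B i 0 - box_side B / 2,
                                 box_center B i 0 + box_side B / 2]].

Definition box_dilate (s : R) (B : box) : box :=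
  Box (box_center B) (s * box_side B).

Definition boundary (A : set 'cV[R]_d) : set 'cV[R]_d :=
  closure A `\` interior A.

Definition tiled_by (Bs : set box) : Prop :=
  \bigcup_(B in Bs) box_set B = setT /\
  trivIset Bs (fun B => interior (box_set B)).

Definition adjacent (B1 B2 : box) : Prop :=
  boundary (box_set B1) `&` boundary (box_set B2) !=set0.

Definition slowly_varying (r : R -> R) (Bs : set box) : Prop :=
  forall B1 B2, Bs B1 -> Bs B2 -> adjacent B1 B2 ->
    let M := Num.max (box_side B1) (box_side B2) in
    let m := Num.min (box_side B1) (box_side B2) in
    M <= m * (1 + 1 / r M).

End Boxes.

Arguments box : clear implicits.

(* Main.v *)
(** Boxes of side at least s meeting a cube of radius s are separated by the
points of a grid of mesh s/2, so there are at most N = 8^d of them. The boxes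
meeting a small cube form a connected adjacency graph, because the cube is
connected, and one reaches all of them from a given box in at most N steps:
otherwise N + 1 boxes of comparable size would meet the cube. Hence the side
length changes by a factor of at most (1 + 1/r)^N over a distance proportional
to the side, and by at most 2 over a distance of order r(l) l. One can thus
take rho of order r(l). The tiles with rho <= t then have
(ln ln l)^a <= O(t) for some a > 1, so there are exp (O(t^(1/a))) dyadic scales
among them and ln K(t) / t^2 is integrable. *)

Require Import Defs.
From HB Require Import structures.
From mathcomp Require Import all_boot all_order all_algebra.
From mathcomp Require Import all_classical all_reals all_analysis.
From mathcomp Require Import ring lra.

Set Implicit Arguments.
Unset Strict Implicit.
Unset Printing Implicit Defensive.

Import Order.TTheory GRing.Theory Num.Theory.
Import numFieldNormedType.Exports.

Local Open Scope classical_set_scope.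
Local Open Scope ring_scope.
Local Open Scope card_scope.

(** * Cubes in the sup norm *)

Section BoxGeometry.
Variables (R : realType) (d : nat).
Implicit Types (x y : 'cV[R]_d) (B : box R d).

Lemma cV_norm_leP (x : 'cV[R]_d) (e : R) :
  0 <= e -> (`|x| <= e) <-> (forall i, `|x i 0| <= e).
Proof.
move=> e0; rewrite /Num.norm /= mx_normrE; split => [|H].
  by move=> /bigmax_leP[_ H] i; exact: (H (i, ord0)).
by apply/bigmax_leP; split=> // ij _; rewrite (ord1 ij.2); exact: H.
Qed.

Lemma cV_norm_ltP (x : 'cV[R]_d) (e : R) :
  0 < e -> (`|x| < e) <-> (forall i, `|x i 0| < e).
Proof.
move=> e0; rewrite /Num.norm /= mx_normrE; split => [|H].
  by move=> /bigmax_ltP[_ H] i; exact: (H (i, ord0)).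
by apply/bigmax_ltP; split=> // ij _; rewrite (ord1 ij.2); exact: H.
Qed.

Lemma cV_norm_coord (x : 'cV[R]_d) i : `|x i 0| <= `|x|.
Proof. by have /cV_norm_leP := lexx `|x|; apply. Qed.

Lemma box_setP B x :
  0 <= box_side B -> box_set B x <-> `|x - box_center B| <= box_side B / 2.
Proof.
move=> B0; rewrite cV_norm_leP ?divr_ge0//.
rewrite /box_set /=; split => H i; move: (H i); rewrite in_itv /= !mxE ler_distl//.
Qed.

Lemma box_center_in B : 0 <= box_side B -> box_set B (box_center B).
Proof. by move=> B0; apply/box_setP => //; rewrite subrr normr0 divr_ge0. Qed.

Lemma interior_boxP B x :
  `|x - box_center B| < box_side B / 2 -> interior (box_set B) x.
Proof.
move=> h.
have B0 : 0 <= box_side B.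
  by have := le_lt_trans (normr_ge0 _) h; rewrite pmulr_lgt0// => /ltW.
apply/nbhs_ballP; exists (box_side B / 2 - `|x - box_center B|) => /=.
  by rewrite subr_gt0.
move=> y; rewrite mx_norm_ball /ball_ /= => xy.
apply/box_setP => //.
have -> : y - box_center B = (x - box_center B) - (x - y).
  by rewrite opprB [RHS]addrC addrA addrNK.
by rewrite (le_trans (ler_normB _ _))// ltW// addrC -ltrBrDr.
Qed.

Lemma closed_box B : 0 <= box_side B -> closed (box_set B).
Proof.
move=> B0.
have -> : box_set B =
    (fun x => `|x - box_center B|) @^-1` [set t | t <= box_side B / 2].
  by apply/seteqP; split => x /box_setP; apply.
apply: preimage_closed; last exact: closed_le.
move=> x _; apply: (@continuous_comp _ _ _ (fun x => x - box_center B) (fun x => `|x|)).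
  by apply: continuousB; [exact: cvg_id|exact: cst_continuous].
exact: norm_continuous.
Qed.

(** Pulling [x] towards the center by the factor [1 - s] lands in the interior, and
    [s = e / (h + 2e)] keeps the displacement, at most [s h / 2], below [e]. *)
Lemma box_meets_interior B x (U : set 'cV[R]_d) :
  0 < box_side B -> box_set B x -> nbhs x U ->
  exists2 y, U y & interior (box_set B) y.
Proof.
move=> B0 /(box_setP _ (ltW B0)) Bx /nbhs_ballP[e /= e0 eU].
set h := box_side B in B0 Bx *.
have D0 : 0 < h + 2 * e by lra.
pose s := e / (h + 2 * e).
have s0 : 0 < s by rewrite divr_gt0.
have s1 : s < 1 by rewrite ltr_pdivrMr// mul1r; lra.
exists (x - s *: (x - box_center B)).
  apply: eU; rewrite mx_norm_ball /ball_ /= opprB addrC addrNK normrZ gtr0_norm//.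
  apply: (@le_lt_trans _ _ (s * (h / 2))); first by rewrite ler_pM2l.
  by rewrite /s mulrAC ltr_pdivrMr//; nra.
apply: interior_boxP.
have -> : x - s *: (x - box_center B) - box_center B =
    (1 - s) *: (x - box_center B).
  by rewrite scalerBl scale1r addrAC.
rewrite normrZ gtr0_norm ?subr_gt0//.
apply: (@le_lt_trans _ _ ((1 - s) * (h / 2))); first by rewrite ler_pM2l ?subr_gt0.
by rewrite -/h; nra.
Qed.

Lemma disjoint_interiors_boundary B1 B2 x :
  0 < box_side B2 -> interior (box_set B1) `&` interior (box_set B2) = set0 ->
  box_set B1 x -> box_set B2 x -> boundary (box_set B1) x.
Proof.
move=> B20 dis B1x B2x; split; first exact: subset_closure.
move=> iB1.
have [|y iy1 iy2] := @box_meets_interior B2 x (interior (box_set B1)) B20 B2x.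
  by apply: open_nbhs_nbhs; split => //; exact: open_interior.
by have : (set0 : set 'cV[R]_d) y by rewrite -dis.
Qed.

(** A nearest point of [B] to [x] in the sup norm. *)
Definition box_clamp B x : 'cV[R]_d :=
  \col_i Num.min (Num.max (x i 0) (box_center B i 0 - box_side B / 2))
                 (box_center B i 0 + box_side B / 2).

Lemma box_clamp_in B x : 0 <= box_side B -> box_set B (box_clamp B x).
Proof.
move=> B0 i; rewrite /box_clamp mxE in_itv /=.
rewrite ge_min lexx orbT andbT le_min le_max lexx orbT /=; lra.
Qed.

Lemma box_clamp_dist B c x : 0 <= box_side B -> 0 <= c ->
  box_set (box_dilate (1 + 2 * c) B) x ->
  `|x - box_clamp B x| <= c * box_side B.
Proof.
move=> B0 c0 Bx; apply/cV_norm_leP; first by rewrite mulr_ge0.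
move=> i; rewrite !mxE; move: (Bx i); rewrite in_itv /=.
set a := box_center B i 0; set h := box_side B in B0 *; set t := x i 0.
move=> /andP[h1 h2]; rewrite ler_norml.
have ch := mulr_ge0 c0 B0.
case: (leP t (a - h / 2)) => h3.
  by case: (leP (a - h / 2) (a + h / 2)) => h4; apply/andP; split; lra.
by case: (leP t (a + h / 2)) => h4; apply/andP; split; lra.
Qed.

End BoxGeometry.

(** * Reachability in a graph whose vertices have finite codes *)

Section Layers.
Variables (T : Type) (E : T -> T -> Prop) (F : set T) (x0 : T).

Fixpoint layer (k : nat) : set T :=
  if k is k'.+1 then
    layer k' `|` [set y | F y /\ exists2 x, layer k' x & E x y]
  else [set x0].

Lemma layer_mono k n : (k <= n)%N -> layer k `<=` layer n.
Proof.
elim: n => [|n IHn]; first by rewrite leqn0 => /eqP ->.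
by rewrite leq_eqVlt => /predU1P[->//|/IHn H x /H]; left.
Qed.

(* Otherwise the images under [g] of the layers 0, ..., #|X| would form a
   strictly increasing chain of #|X| + 1 nonempty subsets of [X]. *)
Lemma layer_saturates (X : finType) (g : T -> X) :
  F x0 ->
  (forall x y, layer #|X| x -> layer #|X| y -> g x = g y -> x = y) ->
  (forall S : set T, S `<=` F -> S x0 ->
     (forall x y, S x -> F y -> E x y -> S y) -> F `<=` S) ->
  F `<=` layer #|X|.
Proof.
move=> Fx0 ginj conn.
pose G k := [set v | `[< exists2 x, layer k x & g x = v >]]%SET.
have memG k x : layer k x -> g x \in G k.
  by move=> kx; rewrite inE; apply/asboolP; exists x.
have Gmono k : G k \subset G k.+1.
  apply/fintype.subsetP => v; rewrite inE => /asboolP[x kx <-].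
  by apply: memG; left.
have [k kN GE] : exists2 k, (k < #|X|)%N & G k.+1 \subset G k.
  apply: contrapT => H.
  have : forall k, (k <= #|X|)%N -> (k < #|G k|)%N.
    elim=> [_|k IHk kX].
      by rewrite card_gt0; apply/set0Pn; exists (g x0); exact: memG.
    apply: (leq_ltn_trans (IHk (ltnW kX))); apply: proper_card.
    rewrite properE Gmono /=; apply/negP => GE; by apply: H; exists k.
  by move=> /(_ _ (leqnn _)); rewrite ltnNge max_card.
(* Equal sets of codes give equal layers, since [g] is injective on the last layer, which contains
   both. *)
have stable : layer k.+1 `<=` layer k.
  move=> x kx; have /(fintype.subsetP GE) := memG _ _ kx.
  rewrite inE => /asboolP[y ky gyx].
  rewrite -(ginj y x _ _ gyx)//.
    exact: (layer_mono (ltnW kN) ky).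
  exact: (layer_mono kN kx).
have layerF j : layer j `<=` F.
  by elim: j => [x ->//|j IHj x [/IHj//|[]]].
apply: (subset_trans (conn _ (layerF k) _ _)).
- exact: (layer_mono (leq0n k)).
- by move=> x y kx Fy xy; apply: stable; right; split=> //; exists x.
- exact: layer_mono (ltnW kN).
Qed.

End Layers.

Lemma inj_finType_card_le (T : Type) (X : finType) (A : set T) (g : T -> X) :
  (forall x y, A x -> A y -> g x = g y -> x = y) -> A #<= `I_#|X|.
Proof.
move=> ginj; pose f x : nat := enum_rank (g x).
have finj : {in A &, injective f}.
  by move=> x y /set_mem Ax /set_mem Ay /ord_inj/enum_rank_inj; exact: ginj.
rewrite -(card_le_eql (inj_card_eq finj)); apply: subset_card_le.
by move=> _ [x _ <-]; exact: ltn_ord.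
Qed.

(** * Tilings by boxes *)

Section Grid.
Variables (R : realType) (d : nat) (s : R) (n : nat) (x0 : 'cV[R]_d).
Hypothesis s_gt0 : 0 < s.

Definition grid_point (f : {ffun 'I_d -> 'I_(4 * n + 4)}) : 'cV[R]_d :=
  \col_i (x0 i 0 - n.+1%:R * s + s / 2 * (f i)%:R).

(** Near [q] the box contains a cube of side [s], and a grid of mesh [s / 2] has a point strictly
    inside that cube. *)
Lemma grid_point_in_box (B : box R d) q :
  s <= box_side B -> box_set B q -> `|q - x0| <= n%:R * s ->
  exists f, interior (box_set B) (grid_point f).
Proof.
move=> sB Bq qx0.
set h := box_side B in sB *.
(* Lower corner of a cube of side [s] inside [B] that contains [q]; [t] is its position in grid
   units. *)
pose a i := Num.max (box_center B i 0 - h / 2) (q i 0 - s).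
pose t i := (a i - x0 i 0 + n.+1%:R * s) / (s / 2).
have natS : n.+1%:R = n%:R + 1 :> R by rewrite natr1.
have aq i : [/\ q i 0 - s <= a i, box_center B i 0 - h / 2 <= a i,
    a i <= q i 0 & a i + s <= box_center B i 0 + h / 2].
  move: (Bq i); rewrite in_itv /= -/h => /andP[q1 q2].
  rewrite /a; split; rewrite ?le_max ?lexx ?orbT//.
    by rewrite ge_max q1 /= gerBl ltW.
  by case: (leP (box_center B i 0 - h / 2) (q i 0 - s)) => ?; lra.
have qx i : - (n%:R * s) <= q i 0 - x0 i 0 <= n%:R * s.
  have := le_trans (cV_norm_coord (q - x0) i) qx0.
  by rewrite !mxE ler_norml.
have s2 : 0 < s / 2 by rewrite divr_gt0.
have tE i : s / 2 * t i = a i - x0 i 0 + n.+1%:R * s.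
  by rewrite /t mulrC divfK// gt_eqF.
have t0 i : 0 <= t i.
  rewrite divr_ge0 ?(ltW s2)// natS.
  by case: (aq i) (qx i) => a1 _ _ _ /andP[b1 b2]; lra.
have tM i : t i < 4 * n%:R + 3.
  rewrite -(ltr_pM2l s2) tE natS.
  by case: (aq i) (qx i) => _ _ a1 _ /andP[b1 b2]; lra.
have tr i := truncn_itv (t0 i).
(* The index is the truncation plus one, so that the grid point exceeds [a i] strictly, by at most
   [s / 2]. *)
have kP i : ((Num.truncn (t i)).+1 < 4 * n + 4)%N.
  have : (Num.truncn (t i) < 4 * n + 3)%N.
    by rewrite truncn_lt_nat// natrD natrM.
  by rewrite !addnS.
exists [ffun i => Ordinal (kP i)].
apply: interior_boxP.
rewrite -/h; apply/cV_norm_ltP; first by lra.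
move=> i; rewrite !mxE ffunE /= ltr_norml.
case/andP: (tr i) => tr1 tr2; case: (aq i) => a1 a2 a3 a4.
move: tr1 tr2; rewrite -natr1 -(ler_pM2l s2) -(ltr_pM2l s2) tE => tr1 tr2.
by apply/andP; split; lra.
Qed.

End Grid.

Section Tiling.
Variables (R : realType) (d : nat) (Bs : set (box R d)).
Hypothesis Bs_tiling : tiled_by Bs.
Hypothesis Bs_side : forall B, Bs B -> 1 <= box_side B.

Lemma tiling_cover x : exists2 B, Bs B & box_set B x.
Proof. by have : setT x by []; rewrite -Bs_tiling.1. Qed.

Lemma tiling_interior_inj B1 B2 y : Bs B1 -> Bs B2 ->
  interior (box_set B1) y -> interior (box_set B2) y -> B1 = B2.
Proof. by move=> h1 h2 i1 i2; apply: Bs_tiling.2 => //; exists y. Qed.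

Lemma tiling_side_gt0 B : Bs B -> 0 < box_side B.
Proof. by move=> /Bs_side; apply: lt_le_trans. Qed.

(** Disjoint interiors force a common point onto both boundaries. *)
Lemma touching_adjacent B1 B2 x : Bs B1 -> Bs B2 -> B1 <> B2 ->
  box_set B1 x -> box_set B2 x -> Defs.adjacent B1 B2.
Proof.
move=> h1 h2 ne x1 x2.
have dis : interior (box_set B1) `&` interior (box_set B2) = set0.
  by apply/seteqP; split => // y [i1 i2]; apply: ne; exact: tiling_interior_inj i1 i2.
exists x; split.
  exact: disjoint_interiors_boundary (tiling_side_gt0 h2) dis x1 x2.
rewrite setIC in dis.
exact: disjoint_interiors_boundary (tiling_side_gt0 h1) dis x2 x1.
Qed.

Definition boxes_near (x0 : 'cV[R]_d) (a : R) : set (box R d) :=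
  [set B | Bs B /\ exists2 q, box_set B q & `|q - x0| <= a].

(** The code of a box is a grid point in its interior; interiors are disjoint, so the code
    determines the box. *)
Lemma grid_code (s : R) (n : nat) x0 : 0 < s ->
  exists g : box R d -> {ffun 'I_d -> 'I_(4 * n + 4)},
    forall B B', boxes_near x0 (n%:R * s) B -> boxes_near x0 (n%:R * s) B' ->
      s <= box_side B -> s <= box_side B' -> g B = g B' -> B = B'.
Proof.
move=> s0.
have /choice[g gP] : forall B, exists f : {ffun 'I_d -> 'I_(4 * n + 4)},
    boxes_near x0 (n%:R * s) B -> s <= box_side B ->
    interior (box_set B) (grid_point s x0 f).
  move=> B; have [[hB sB]|nh] :=
      pselect (boxes_near x0 (n%:R * s) B /\ s <= box_side B).
    by case: hB => _ [q Bq qx]; have [f fP] := grid_point_in_box s0 sB Bq qx; exists f.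
  (* A dummy code for boxes that are too far or too small. *)
  have k : (0 < 4 * n + 4)%N by rewrite addnS.
  by exists [ffun=> Ordinal k] => h1 h2; case: nh.
exists g => B B' nB nB' sB sB' gBB'.
apply: (@tiling_interior_inj B B' (grid_point s x0 (g B))).
- by case: nB.
- by case: nB'.
- exact: gP.
- by rewrite gBB'; exact: gP.
Qed.

(** All sides are at least 1, so a grid of mesh 1/2 codes every box in the range. *)
Lemma finite_boxes_near x0 a : finite_set (boxes_near x0 a).
Proof.
have [g gP] := @grid_code 1 (Num.truncn a).+1 x0 ltr01.
apply/finite_set_leP; exists #|{: {ffun 'I_d -> 'I_(4 * (Num.truncn a).+1 + 4)}}|.
have sub B : boxes_near x0 a B -> boxes_near x0 ((Num.truncn a).+1%:R * 1) B.
  case=> hB [q Bq qa]; split=> //; exists q => //; rewrite mulr1.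
  have a0 : 0 <= a by exact: le_trans qa.
  by have /andP[_ /ltW] := truncn_itv a0; exact: le_trans.
apply: (@inj_finType_card_le _ _ _ g) => B B' nB nB'.
by apply: gP; [exact: sub|exact: sub|apply: Bs_side; case: nB|apply: Bs_side; case: nB'].
Qed.

Lemma closed_tiling_union (S : set (box R d)) x0 a :
  S `<=` boxes_near x0 a -> closed (\bigcup_(B in S) box_set B).
Proof.
move=> SF; apply: (@closed_bigcup _ {classic box R d}).
  exact: sub_finite_set SF (finite_boxes_near x0 a).
by move=> B /SF[/tiling_side_gt0 /ltW B0 _]; exact: closed_box.
Qed.

(** The segment from [x0] to a point of [B] stays within distance [a]. If [B] were outside [S], the
    boxes in [S] and the remaining ones would split it into two disjoint nonempty parts, both closed
    because the unions are finite. *)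
Lemma boxes_near_connected x0 a B0 (S : set (box R d)) :
  box_set B0 x0 -> S `<=` boxes_near x0 a -> S B0 ->
  (forall B B', S B -> boxes_near x0 a B' ->
     box_set B `&` box_set B' !=set0 -> S B') ->
  boxes_near x0 a `<=` S.
Proof.
move=> B0x SF SB0 Sclosed B nB; apply: contrapT => nSB.
have [hB [q Bq qx]] := nB.
pose g (t : R) := x0 + t *: (q - x0).
have gc : continuous g.
  by move=> t; apply: cvgD; [exact: cvg_cst|apply: cvgZr_tmp; exact: cvg_id].
pose U := \bigcup_(B in S) box_set B.
pose V := \bigcup_(B in boxes_near x0 a `\` S) box_set B.
have cU : closed U by exact: closed_tiling_union SF.
have cV : closed V.
  by apply: (@closed_tiling_union _ x0 a) => ? [].
have UV x : U x -> V x -> False.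
  move=> [B1 SB1 x1] [B2 [nB2 nSB2] x2]; apply: nSB2.
  by apply: (Sclosed B1) => //; exists x.
have gUV t : `[0, 1]%classic t -> U (g t) \/ V (g t).
  rewrite /= in_itv /= => /andP[t0 t1].
  have [B' hB' gB'] := tiling_cover (g t).
  have nB' : boxes_near x0 a B'.
    split=> //; exists (g t) => //.
    rewrite /g addrC addKr normrZ ger0_norm//.
    by apply: le_trans qx; rewrite ler_piMl.
  by have [SB'|nSB'] := pselect (S B'); [left; exists B'|right; exists B'].
have : `[0, 1]%classic `&` g @^-1` U = `[0, 1]%classic.
  apply: segment_connected.
  - exists 0; split; first by rewrite /= in_itv /= lexx ler01.
    by exists B0 => //; rewrite /g scale0r addr0.
  - exists (g @^-1` (~` V)).
      by apply: open_comp; [move=> ? _; exact: gc|exact: closed_openC].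
    apply/seteqP; split => t [h1 h2]; split => //.
      by move=> Vt; exact: UV h2 Vt.
    by case: (gUV _ h1).
  - by exists (g @^-1` U) => //; apply: preimage_closed => // ? _; exact: gc.
move=> /seteqP[_ /(_ 1)] H.
have [|_ U1] := H; first by rewrite /= in_itv /= lexx ler01.
apply: (UV (g 1)) => //.
by exists B => //; rewrite /g scale1r addrC subrK.
Qed.

End Tiling.

(** * Variation of the side length along a tiling *)

Section SlowTiling.
Variables (R : realType) (d : nat) (r : R -> R) (Bs : set (box R d)).
Hypothesis r_pos : forall t, 1 <= t -> 0 < r t.
Hypothesis r_incr : nondecreasing_from1 r.
Hypothesis Bs_tiling : tiled_by Bs.
Hypothesis Bs_side : forall B, Bs B -> 1 <= box_side B.
Hypothesis Bs_slow : slowly_varying r Bs.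

Let touch (B B' : box R d) := box_set B `&` box_set B' !=set0.

Lemma invr_r_mono u v : 1 <= u -> u <= v -> 1 / r v <= 1 / r u.
Proof.
move=> u1 uv; have v1 := le_trans u1 uv.
rewrite !div1r lef_pV2 ?posrE ?r_pos//.
by apply: r_incr => //; rewrite in_itv /= ?u1 ?v1.
Qed.

(** The larger side is at least [u] and [1 / r] is nonincreasing, so [u] may replace the larger side
    in the adjacency condition. *)
Lemma touch_ratio u B1 B2 : Bs B1 -> Bs B2 -> touch B1 B2 ->
  1 <= u -> u <= box_side B1 -> box_side B2 <= box_side B1 * (1 + 1 / r u).
Proof.
move=> h1 h2 [x [x1 x2]] u1 uB1.
have ru0 : 0 <= 1 / r u by rewrite divr_ge0// ltW// r_pos.
have B10 := tiling_side_gt0 Bs_side h1.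
have [->|ne] := pselect (B2 = B1).
  by rewrite ler_peMr ?(ltW B10)// lerDl.
have := Bs_slow h1 h2 (touching_adjacent Bs_tiling Bs_side h1 h2 (nesym ne) x1 x2).
move=> /= H; apply: le_trans (le_trans H _); first by rewrite le_max lexx orbT.
apply: ler_pM.
- by rewrite le_min !ltW// (tiling_side_gt0 Bs_side h2).
- by rewrite addr_ge0// divr_ge0// ltW// r_pos// le_max (Bs_side h1).
- by rewrite ge_min lexx.
- by rewrite lerD2l invr_r_mono// le_max uB1.
Qed.

(** Each layer costs one factor [lam], in both directions because touching is symmetric. *)
Lemma layer_ratio (F : set (box R d)) B0 (lam : R) k B : 1 <= lam ->
  (forall B, F B -> 0 < box_side B) -> F B0 ->
  (forall B1 B2, F B1 -> F B2 -> touch B1 B2 ->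
     box_side B2 <= box_side B1 * lam) ->
  layer touch F B0 k B ->
  [/\ F B, box_side B <= box_side B0 * lam ^+ k
    & box_side B0 <= box_side B * lam ^+ k].
Proof.
move=> lam1 F0 FB0 step; elim: k B => [B ->|k IHk B]; first by rewrite expr0 !mulr1.
have lam0 : 0 <= lam by exact: le_trans lam1.
have grow x : 0 < x -> x * lam ^+ k <= x * lam ^+ k.+1.
  by move=> x0; rewrite ler_pM2l// exprS ler_peMl// exprn_ge0.
case=> [/IHk[FB h1 h2]|[FB [B' /IHk[FB' h1 h2] BB']]]; split=> //.
- exact: le_trans (grow _ (F0 _ FB0)).
- exact: le_trans (grow _ (F0 _ FB)).
- by rewrite exprSr mulrA (le_trans (step _ _ FB' FB BB'))// ler_wpM2r.
- rewrite exprS mulrA (le_trans h2)// ler_wpM2r ?exprn_ge0//.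
  by apply: step => //; case: BB' => x [x1 x2]; exists x.
Qed.

(* Equal to 8^d, the size of the grid of [grid_code] for n = 1. *)
Definition chain_bound : nat := #|{: {ffun 'I_d -> 'I_(4 * 1 + 4)}}|.

(* Chosen so that [chain_bound] steps shrink the side at most by this factor,
   whatever the sizes of the boxes (reachK). *)
Definition reach : R := (1 + 1 / r 1)^-1 ^+ chain_bound.

Lemma lam_ge1 u : 1 <= u -> 1 <= 1 + 1 / r u.
Proof. by move=> u1; rewrite lerDl divr_ge0// ltW// r_pos. Qed.

Lemma reach_gt0 : 0 < reach.
Proof. by rewrite exprn_gt0// invr_gt0 (lt_le_trans ltr01)// lam_ge1. Qed.

Lemma reach_le1 : reach <= 1.
Proof.
have l1 := lam_ge1 (lexx 1).
by rewrite exprn_ile1// ?invr_ge0 ?(le_trans ler01)// invf_le1// (lt_le_trans ltr01).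
Qed.

Lemma reachK : reach * (1 + 1 / r 1) ^+ chain_bound = 1.
Proof.
rewrite -exprMn mulVf ?expr1n// gt_eqF// (lt_le_trans ltr01)//.
exact: lam_ge1.
Qed.

(** A bootstrap. The crude ratio [1 + 1 / r 1] shows that the boxes in the first [chain_bound]
    layers have side at least [s], so the grid separates them and the layers exhaust the boxes near
    [x0]. Hence all of these have side at least [s], and the same chains can be run again with the
    sharper ratio. *)
Lemma local_ratio x0 B0 B : Bs B0 -> box_set B0 x0 ->
  boxes_near Bs x0 (reach * box_side B0) B ->
  let lam := 1 + 1 / r (Num.max 1 (reach * box_side B0)) in
  box_side B <= box_side B0 * lam ^+ chain_bound /\
  box_side B0 <= box_side B * lam ^+ chain_bound.
Proof.
move=> h0 x00 nB /=.
set s := reach * box_side B0; pose F := boxes_near Bs x0 s.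
have B00 := tiling_side_gt0 Bs_side h0.
have s0 : 0 < s by rewrite mulr_gt0// reach_gt0.
have FB0 : F B0 by split=> //; exists x0 => //; rewrite subrr normr0 ltW.
have F0 B1 : F B1 -> 0 < box_side B1 by case=> /(tiling_side_gt0 Bs_side).
have l1 := lam_ge1 (lexx 1).
have layerN B1 : layer touch F B0 chain_bound B1 -> F B1 /\ s <= box_side B1.
  move=> /(layer_ratio l1 F0 FB0)[|FB1 _ H].
    by move=> B2 B3 [h2 _] [h3 _] /touch_ratio; apply => //; exact: Bs_side.
  split=> //; rewrite /s -(ler_pM2r (exprn_gt0 chain_bound (lt_le_trans ltr01 l1))).
  by rewrite [reach * _]mulrC -mulrA reachK mulr1.
have FN : F `<=` layer touch F B0 chain_bound.
  have [g gP] := @grid_code _ _ _ Bs_tiling s 1 x0 s0.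
  apply: (layer_saturates (g := g)) => //.
    by move=> B1 B2 /layerN[F1 s1] /layerN[F2 s2]; apply: gP => //; rewrite mul1r.
  move=> S SF SB0 Sclosed; exact: boxes_near_connected x00 SF SB0 _.
have sF B1 : F B1 -> s <= box_side B1 by move=> /FN/layerN[].
have m1 : 1 <= Num.max 1 s by rewrite le_max lexx.
have [|_ H1 H2] := layer_ratio (lam_ge1 m1) F0 FB0 _ (FN _ nB); last by split.
move=> B1 B2 F1 F2 t12; apply: touch_ratio => //.
- by case: F1.
- by case: F2.
- by rewrite ge_max sF// andbT; case: F1 => /Bs_side.
Qed.

(** The ratio of [local_ratio] is at most the crude one, whose power is the inverse of [reach]. *)
Lemma local_ratio_reach x0 B0 B : Bs B0 -> box_set B0 x0 ->
  boxes_near Bs x0 (reach * box_side B0) B ->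
  reach * box_side B <= box_side B0 /\ reach * box_side B0 <= box_side B.
Proof.
move=> h0 x00 nB; have [H1 H2] := local_ratio h0 x00 nB.
set m := Num.max _ _ in H1 H2; have m1 : 1 <= m by rewrite le_max lexx.
have hB : Bs B by case: nB.
have lamN : (1 + 1 / r m) ^+ chain_bound <= (1 + 1 / r 1) ^+ chain_bound.
  rewrite lerXn2r ?nnegrE ?(le_trans ler01 (lam_ge1 _))//.
  by rewrite lerD2l invr_r_mono.
have main x y : 0 < y -> x <= y * (1 + 1 / r m) ^+ chain_bound -> reach * x <= y.
  move=> y0 H; rewrite -[leRHS]mul1r -reachK -mulrA ler_wpM2l ?(ltW reach_gt0)//.
  by rewrite (le_trans H)// mulrC ler_wpM2r// ltW.
by split; apply: main => //; exact: (tiling_side_gt0 Bs_side).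
Qed.

(** Walk from [x0] to [y] in [n + 1] steps of length at most [s]. Since [mu ^+ n.+1 <= 2], every box
    on the way has at least half the side of [B0]; as [s] is half the reach of [B0], the next step
    stays within reach of the current box. *)
Lemma chain_ratio x0 B0 n y B : Bs B0 -> box_set B0 x0 ->
  let s := reach * box_side B0 / 2 in
  let mu := (1 + 1 / r (Num.max 1 s)) ^+ chain_bound in
  Bs B -> box_set B y -> `|y - x0| <= n.+1%:R * s -> mu ^+ n.+1 <= 2 ->
  box_side B <= box_side B0 * mu ^+ n.+1 /\
  box_side B0 <= box_side B * mu ^+ n.+1.
Proof.
move=> h0 x00 s mu.
have B00 := tiling_side_gt0 Bs_side h0.
have s0 : 0 < s by rewrite divr_gt0// mulr_gt0// reach_gt0.
have ms1 : 1 <= Num.max 1 s by rewrite le_max lexx.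
have mu1 : 1 <= mu by rewrite exprn_ege1// lam_ge1.
have mu0 : 0 <= mu by exact: le_trans mu1.
have step x B1 z B2 : Bs B1 -> box_set B1 x -> Bs B2 -> box_set B2 z ->
    box_side B0 <= box_side B1 * 2 -> `|z - x| <= s ->
    box_side B2 <= box_side B1 * mu /\ box_side B1 <= box_side B2 * mu.
  move=> h1 x1 h2 x2 B01 zx.
  have sB1 : s <= reach * box_side B1.
    by rewrite /s ler_pdivrMr// -mulrA ler_pM2l// reach_gt0.
  have m1 : Num.max 1 s <= Num.max 1 (reach * box_side B1).
    by rewrite ge_max !le_max lexx sB1 orbT.
  have lmu : (1 + 1 / r (Num.max 1 (reach * box_side B1))) ^+ chain_bound <= mu.
    rewrite lerXn2r ?nnegrE ?(le_trans ler01 (lam_ge1 _))//.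
      by rewrite le_max lexx.
    by rewrite lerD2l invr_r_mono.
  have nB2 : boxes_near Bs x (reach * box_side B1) B2.
    by split=> //; exists z => //; exact: le_trans sB1.
  have [H1 H2] := local_ratio h1 x1 nB2.
  split; [apply: (le_trans H1)|apply: (le_trans H2)];
    by rewrite ler_wpM2l// ltW// (tiling_side_gt0 Bs_side).
elim: n y B => [|n IHn] y B hB By yx mun.
  rewrite expr1; apply: (step x0) => //; last by rewrite mul1r in yx.
  by rewrite ler_peMr ?(ltW B00)// ler1n.
have mun' : mu ^+ n.+1 <= 2.
  by apply: le_trans mun; rewrite [leRHS]exprS ler_peMl// exprn_ge0.
(* The last division point when the segment is cut into [n + 2] equal pieces. *)
pose x := x0 + (n.+1%:R / n.+2%:R) *: (y - x0).
have n2 : n.+2%:R != 0 :> R by rewrite pnatr_eq0.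
have xx0 : `|x - x0| <= n.+1%:R * s.
  rewrite /x addrC addKr normrZ ger0_norm ?divr_ge0//.
  by rewrite mulrAC ler_pdivrMr ?ltr0n// -mulrA ler_pM2l ?ltr0n// mulrC.
have yx' : `|y - x| <= s.
  have -> : y - x = n.+2%:R^-1 *: (y - x0).
    rewrite /x opprD addrA -[X in X - _]scale1r -scalerBl; congr (_ *: _).
    by apply: (mulIf n2); rewrite mulrBl mul1r divfK// mulVf// -natrB// subSnn.
  by rewrite normrZ ger0_norm ?invr_ge0// ler_pdivrMl ?ltr0n.
have [B1 h1 x1] := tiling_cover Bs_tiling x.
have [H1 H2] := IHn _ _ h1 x1 xx0 mun'.
have B10 := tiling_side_gt0 Bs_side h1.
have [|K1 K2] := step _ _ _ _ h1 x1 hB By _ yx'.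
  by rewrite (le_trans H2)// ler_pM2l.
rewrite exprSr !mulrA; split.
  by apply: (le_trans K1); rewrite ler_wpM2r.
by apply: (le_trans H2); rewrite mulrAC ler_wpM2r// exprn_ge0.
Qed.

(** By induction [(1 + x)^m (1 - m x) <= 1], and here [1 - n x >= 1/2]. *)
Lemma bernoulli_le2 (x : R) n : 0 <= x -> n%:R * x <= 2^-1 -> (1 + x) ^+ n <= 2.
Proof.
move=> x0 nx.
have H m : (1 + x) ^+ m * (1 - m%:R * x) <= 1.
  elim: m => [|m IHm]; first by rewrite mul0r subr0 mul1r.
  apply: le_trans IHm; rewrite exprSr -mulrA ler_wpM2l ?exprn_ge0 ?addr_ge0//.
  by rewrite -natr1; have := ler0n R m; nra.
have := H n; have : 0 <= (1 + x) ^+ n by rewrite exprn_ge0// addr_ge0.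
by nra.
Qed.

(** About [r / (2 chain_bound)] steps are allowed, so sides stay comparable up to a distance of
    order [r] times the side of [B0]. *)
Lemma far_ratio x0 B0 n y B : Bs B0 -> box_set B0 x0 ->
  let s := reach * box_side B0 / 2 in
  Bs B -> box_set B y -> `|y - x0| <= n.+1%:R * s ->
  n.+1%:R * chain_bound%:R <= r (Num.max 1 s) / 2 ->
  box_side B <= box_side B0 * 2 /\ box_side B0 <= box_side B * 2.
Proof.
move=> h0 x00 s hB By yx nr.
have rs : 0 < r (Num.max 1 s) by apply: r_pos; rewrite le_max lexx.
have mu2 : ((1 + 1 / r (Num.max 1 s)) ^+ chain_bound) ^+ n.+1 <= 2.
  rewrite -exprM; apply: bernoulli_le2; first by rewrite divr_ge0// ltW.
  by rewrite natrM mulrA mulr1 ler_pdivrMr// mulrC [leRHS]mulrC.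
have [H1 H2] := chain_ratio h0 x00 hB By yx mu2.
split; [apply: (le_trans H1)|apply: (le_trans H2)];
  by rewrite ler_wpM2l// ltW// (tiling_side_gt0 Bs_side).
Qed.

End SlowTiling.

(** * Tiles whose tile set is a cube *)

Section TileNorm.
Variables (R : realType) (d : nat).
Implicit Types (D : 'M[R]_d) (v w : 'cV[R]_d) (L : R).

(** [D] is [L] times a linear isometry of the sup norm, expressed through the inverse as tile sets
    are. *)
Definition cube_map L D : Prop :=
  [/\ D \in unitmx, 0 < L & forall v, `|invmx D *m v| = `|v| / L].

Lemma cube_map_norm L D v : cube_map L D -> `|D *m v| = L * `|v|.
Proof.
case=> Du L0 H; have := H (D *m v); rewrite mulKmx// => ->.
by rewrite mulrC divfK// gt_eqF.
Qed.

(** The set is symmetric about [T.2] and about the center of [B], hence invariant under translation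
    by twice their difference; being bounded, it forces them to coincide. The two norms then share a
    ball, and homogeneity makes them proportional. *)
Lemma tile_set_box T (B : box R d) : is_tile T -> 0 < box_side B ->
  tile_set T = box_set B -> T.2 = box_center B /\ cube_map (box_side B) T.1.
Proof.
case: T => D xi; rewrite /is_tile /tile_set /= => Du B0 TB.
set c := box_center B; set L := box_side B in B0 *.
have SP v : `|invmx D *m (v - xi)| <= 2^-1 <-> `|v - c| <= L / 2.
  rewrite -(box_setP _ (ltW B0)) -TB; exact: iff_refl.
(* Central symmetry about [xi], followed by the one about [c]. *)
have refl v : `|v - c| <= L / 2 -> `|v + (c - xi) *+ 2 - c| <= L / 2.
  move=> /SP; rewrite -normrN -mulmxN => H.
  have /SP : `|invmx D *m ((xi *+ 2 - v) - xi)| <= 2^-1.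
    by rewrite mulr2n addrAC addrK -opprB.
  rewrite -normrN => H2; apply: le_trans H2; rewrite le_eqVlt; apply/orP; left; apply/eqP.
  by congr (`|_|); rewrite !mulr2n; apply/matrixP => i j; rewrite !mxE; ring.
have iter k : `|(c - xi) *+ 2 *+ k| <= L / 2.
  suff : `|c + (c - xi) *+ 2 *+ k - c| <= L / 2 by rewrite addrAC subrr add0r.
  elim: k => [|k IHk]; first by rewrite mulr0n addr0 subrr normr0 divr_ge0// ltW.
  by rewrite mulrS [X in c + X]addrC addrA; exact: refl.
have cxi : xi = c.
  apply/esym/eqP; rewrite -subr_eq0 -normr_le0 leNgt; apply/negP => w0.
  have w20 : 0 < `|(c - xi) *+ 2| by rewrite normrMn pmulrn_lgt0.
  have := iter (Num.truncn (L / 2 / `|(c - xi) *+ 2|)).+1.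
  rewrite leNgt normrMn -[X in _ < X]mulr_natl -ltr_pdivrMr// => /negP; apply.
  by have /andP[] := truncn_itv (ltW (divr_gt0 (divr_gt0 B0 (ltr0n _ 2)) w20)).
split=> //; split=> // v.
have NP w : `|invmx D *m w| <= 2^-1 <-> `|w| <= L / 2.
  by have := SP (w + c); rewrite cxi addrK.
have [->|v0] := eqVneq v 0; first by rewrite mulmx0 !normr0 mul0r.
have vpos : 0 < `|v| by rewrite normr_gt0.
have Dv0 : 0 < `|invmx D *m v|.
  rewrite normr_gt0; apply: contra_neq v0 => H.
  by rewrite -[v](mulKVmx Du) H mulmx0.
apply/eqP; rewrite eq_le; apply/andP; split.
  (* Rescaling [v] to the boundary of each ball in turn gives the two inequalities. *)
  have /NP : `|(L / 2 / `|v|) *: v| <= L / 2.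
    by rewrite normrZ ger0_norm ?divr_ge0// ?(ltW B0)// divfK// gt_eqF.
  rewrite -scalemxAr normrZ ger0_norm ?divr_ge0// ?(ltW B0)// => H.
  rewrite ler_pdivlMr//; move: H.
  rewrite mulrAC ler_pdivrMr// => H.
  have -> : `|v| = 2 * (2^-1 * `|v|) by rewrite mulrA divff// mul1r.
  by apply: le_trans (ler_wpM2l _ H) => //; rewrite mulrCA mulrA divfK// mulrC.
have /NP : `|invmx D *m ((2 * `|invmx D *m v|)^-1 *: v)| <= 2^-1.
  rewrite -scalemxAr normrZ ger0_norm ?invr_ge0 ?mulr_ge0//.
  by rewrite invfM -mulrA mulVf ?mulr1// gt_eqF.
rewrite normrZ ger0_norm ?invr_ge0 ?mulr_ge0// => H.
rewrite ler_pdivrMr//; move: H; rewrite mulrC ler_pdivrMr ?mulr_gt0//.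
by rewrite mulrA divfK// mulrC.
Qed.

Lemma op_norm_le D b : 0 <= b -> (forall v, `|D *m v| <= b * `|v|) ->
  op_norm D <= b.
Proof.
move=> b0 H; apply: ge_sup.
  by exists `|D *m (0 : 'cV[R]_d)|, 0 => //=; rewrite normr0.
move=> _ [v /= v1 <-]; apply: (le_trans (H v)).
by rewrite ler_piMr.
Qed.

Lemma le_ln1 (x b : R) : 1 <= b -> x <= b -> ln x <= ln b.
Proof.
move=> b1 xb; have [x0|x0] := leP x 0; first by rewrite ln0// ln_ge0.
by rewrite ler_ln ?posrE// (lt_le_trans ltr01).
Qed.

Lemma cube_map_op_norm L1 L2 D1 D2 b : cube_map L1 D1 -> cube_map L2 D2 ->
  L2 <= b * L1 -> op_norm (invmx D1 *m D2) <= b.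
Proof.
move=> h1 h2 L21; have [_ L10 N1] := h1; have [_ L20 _] := h2.
have b0 : 0 <= b by rewrite -(pmulr_lge0 _ L10) (le_trans (ltW L20)).
apply: op_norm_le => // v.
by rewrite -mulmxA N1 (cube_map_norm _ h2) ler_pdivrMr// mulrAC ler_wpM2r.
Qed.

Lemma cube_map_dist L1 L2 D1 D2 xi1 xi2 b : cube_map L1 D1 -> cube_map L2 D2 ->
  1 <= b -> L2 <= b * L1 -> L1 <= b * L2 ->
  tile_dist (D1, xi1) (D2, xi2) <= ln b / ln 2.
Proof.
move=> h1 h2 b1 L21 L12.
rewrite /tile_dist /= ler_wpM2r ?invr_ge0 ?ln_ge0// ?ler1n//.
apply: le_ln1 => //.
by rewrite ge_max (cube_map_op_norm h1 h2 L21) (cube_map_op_norm h2 h1 L12).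
Qed.

(* Otherwise [v] would be the midpoint of a segment of the unit cube. *)
Lemma cube_map_vertex L D v : cube_map L D -> (forall i, `|v i 0| = 1) ->
  forall k, `|(D *m v) k 0| = L.
Proof.
move=> h v1 k; have [Du L0 _] := h.
have Dv i : `|(D *m v) i 0| <= L.
  apply: (le_trans (cV_norm_coord _ i)).
  rewrite (cube_map_norm _ h) ler_piMr ?(ltW L0)//.
  by apply/cV_norm_leP => // j; rewrite v1.
apply/eqP; rewrite eq_le Dv /= leNgt; apply/negP => lt.
pose e := L - `|(D *m v) k 0|; have e0 : 0 < e by rewrite subr_gt0.
pose w := invmx D *m (delta_mx k 0 : 'cV[R]_d).
have vw (s : R) : `|s| = 1 -> `|v + (s * e) *: w| <= 1.
  move=> s1; rewrite -(ler_pM2l L0) mulr1 -(cube_map_norm _ h).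
  rewrite mulmxDr -scalemxAr /w mulKVmx//.
  apply/cV_norm_leP; first exact: ltW.
  move=> i; rewrite !mxE eqxx andbT; have := Dv i; rewrite mxE.
  have [->|ik] := eqVneq i k; last by rewrite mulr0 addr0.
  move=> _; rewrite mulr1 (le_trans (ler_normD _ _))// normrM s1 mul1r gtr0_norm//.
  by rewrite /e mxE addrCA subrr addr0.
have w0 : w = 0.
  apply/matrixP => i j; rewrite (ord1 j) [RHS]mxE.
  have := le_trans (cV_norm_coord _ i) (vw 1 (normr1 _)).
  have := le_trans (cV_norm_coord _ i) (vw (-1) (normrN1 _)).
  rewrite ![(_ + _ *: w) i 0]mxE ![(_ *: w) i 0]mxE !mulN1r !mul1r.
  set t := w i 0.
  move: (v1 i) => /eqP; rewrite eqr_norml => /andP[/orP[] /eqP -> _];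
    rewrite !ler_norml => /andP[? ?] /andP[? ?];
    suff : e * t = 0 by [move=> /eqP; rewrite mulf_eq0 gt_eqF// => /eqP];
    by lra.
have : D *m w = 0 by rewrite w0 mulmx0.
rewrite /w mulKVmx// => /matrixP/(_ k 0); rewrite !mxE !eqxx => /eqP.
by rewrite oner_eq0.
Qed.

(* A column of [D] is half the difference of the images of two vertices. *)
Lemma cube_map_entry L D i j : cube_map L D ->
  [\/ D i j = 0, D i j = L | D i j = - L].
Proof.
move=> h; have [_ L0 _] := h.
pose u : 'cV[R]_d := \col_k 1.
pose e : 'cV[R]_d := delta_mx j 0.
have Du : `|(D *m u) i 0| = L.
  by apply: cube_map_vertex h _ _ => k; rewrite mxE normr1.
have Du' : `|(D *m (u - e *+ 2)) i 0| = L.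
  apply: cube_map_vertex h _ _ => k; rewrite mulr2n !mxE eqxx andbT.
  case: (k == j); rewrite /= ?addr0 ?subr0 ?normr1//.
  by rewrite opprD addrA subrr add0r normrN1.
have De : (D *m e) i 0 = D i j.
  rewrite mxE (bigD1 j)//= mxE !eqxx mulr1 big1 ?addr0// => k kj.
  by rewrite mxE (negPf kj) mulr0.
have -> : D i j = ((D *m u) i 0 - (D *m (u - e *+ 2)) i 0) / 2.
  rewrite mulr2n mulmxBr mulmxDr -De.
  rewrite [(_ - _ : 'cV_d) i 0]mxE [(- _ : 'cV_d) i 0]mxE [(_ + _ : 'cV_d) i 0]mxE.
  lra.
move: Du Du' => /eqP; rewrite eqr_norml => /andP[/orP[] /eqP -> _] /eqP;
  rewrite eqr_norml => /andP[/orP[] /eqP -> _].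
- by constructor 1; rewrite subrr mul0r.
- by constructor 2; lra.
- by constructor 3; lra.
- by constructor 1; rewrite subrr mul0r.
Qed.

End TileNorm.

(** * Growth of r and integrability of ln K *)

Section Growth.
Variables (R : realType).

Lemma powR_neg_cvg0 (s : R) : 0 < s -> x `^ (- s) @[x --> +oo] --> (0 : R).
Proof.
move=> s0; apply/cvgrPdist_lt => e e0.
near=> x.
have x0 : 0 < x by near: x; exact: nbhs_pinfty_gt.
have xe : e^-1 `^ s^-1 < x by near: x; apply: nbhs_pinfty_gt; exact: num_real.
rewrite sub0r normrN gtr0_norm ?powR_gt0// powRN invf_plt ?posrE ?powR_gt0//.
have -> : e^-1 = ((e^-1) `^ (s^-1)) `^ s.
  by rewrite -powRrM mulVf ?gt_eqF// powRr1// invr_ge0 ltW.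
by rewrite gt0_ltr_powR ?nnegrE ?powR_ge0 ?(ltW x0).
Unshelve. all: by end_near.
Qed.

(** The antiderivative [F] combines [t^(-1)] and [t^(b - 1)], which both vanish at infinity because
    [b < 1]. *)
Lemma integral_powR_lty (A M b : R) : 0 <= A -> 0 <= M -> b < 1 ->
  (\int[lebesgue_measure]_(t in `[1%R, +oo[)
     ((A + M * t `^ b) / t ^+ 2)%:E < +oo)%E.
Proof.
move=> A0 M0 b1.
pose F (t : R) := - A * t `^ (-1) + M / (b - 1) * t `^ (b - 1).
pose f (t : R) := A * t `^ (-2) + M * t `^ (b - 2).
have fE (t : R) : 1 <= t -> (A + M * t `^ b) / t ^+ 2 = f t.
  move=> t1; have t0 := lt_le_trans ltr01 t1.
  rewrite /f powRD ?(gt_eqF t0) ?implybT// powRN powR_mulrn ?ltW//.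
  by rewrite mulrDl mulrA.
have dF (t : R) : 0 < t -> is_derive t 1 F (f t).
  move=> t0; rewrite /F /f.
  have H1 := is_derive1_powR (-1) t0; have H2 := is_derive1_powR (b - 1) t0.
  apply: is_derive_eq.
  rewrite /GRing.scale /=.
  have -> : -1 - 1 = -2 :> R by lra.
  have -> : b - 1 - 1 = b - 2 :> R by lra.
  rewrite mulrA; congr (_ + _); first by lra.
  by rewrite mulrA divfK// subr_eq0 lt_eqF.
have -> : (\int[lebesgue_measure]_(t in `[1%R, +oo[)
     ((A + M * t `^ b) / t ^+ 2)%:E =
   \int[lebesgue_measure]_(t in `[1%R, +oo[) (f t)%:E)%E.
  by apply: eq_integral => t; rewrite inE /= in_itv /= andbT => /fE ->.
rewrite (@ge0_continuous_FTC2y _ f F 1 0).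
- by rewrite -EFinB ltry.
- move=> t t1; rewrite -fE// divr_ge0 ?sqr_ge0//.
  by rewrite addr_ge0// mulr_ge0// powR_ge0.
- apply: derivable_within_continuous => t; rewrite in_itv /= andbT => t1.
  have t0 := lt_le_trans ltr01 t1.
  have H1 := is_derive1_powR (-2) t0; have H2 := is_derive1_powR (b - 2) t0.
  by apply: derivableD; apply: derivableM.
- rewrite -[X in _ --> X]addr0; apply: cvgD.
    rewrite -[X in _ --> X](mulr0 (- A)); apply: cvgM; first exact: cvg_cst.
    exact: powR_neg_cvg0.
  rewrite -[X in _ --> X](mulr0 (M / (b - 1))); apply: cvgM; first exact: cvg_cst.
  have -> : b - 1 = - (1 - b) by rewrite opprB.
  by apply: powR_neg_cvg0; rewrite subr_gt0.
- by move=> t t1; have [] := dF t (lt_trans ltr01 t1).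
- apply: cvg_at_right_filter; have [+ _] := dF 1 ltr01.
  by move=> /derivable1_diffP/differentiable_continuous.
- move=> t; rewrite in_itv /= andbT => t1.
  by rewrite derive1E; have [_ ->] := dF t (lt_trans ltr01 t1).
Qed.

(** The lower limit is a supremum of infima over neighborhoods of infinity; one of these infima
    already exceeds 1, and it serves as [a] when finite. *)
Lemma growth_exponent (r : R -> R) :
  (1 < limf_einf (fun t : R => (ln (r t) / ln (ln (ln t)))%:E) (pinfty_nbhs R))%E ->
  exists a t0 : R, [/\ 1 < a, 1 <= t0 &
    forall t, t0 < t -> 1 < ln (ln (ln t)) /\ a * ln (ln (ln t)) <= ln (r t)].
Proof.
rewrite /limf_einf /limf_esup lteNr => /ereal_inf_lt[_ [V [m [_ mV]] <-] supV].
have [a a1 aV] : exists2 a : R, 1 < a & forall t, V t -> a <= ln (r t) / ln (ln (ln t)).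
  have ub t : V t -> (- (ln (r t) / ln (ln (ln t)))%:E <=
      ereal_sup [set (\- (fun t : R => (ln (r t) / ln (ln (ln t)))%:E))%E x | x in V])%E.
    by move=> Vt; apply: ereal_sup_ubound; exists t.
  move: supV ub; case: (ereal_sup _) => [s|//|] /=.
    rewrite lte_fin => s1 ub; exists (- s); first by rewrite ltrNr.
    by move=> t /ub; rewrite lee_fin lerNl.
  (* The supremum is minus infinity only if [V] is empty, and then any [a > 1] will do. *)
  by move=> _ ub; exists 2 => [|t /ub]; [lra|rewrite leeNy_eq].
(* Beyond this threshold the triple logarithm exceeds 1, so the denominator can be cleared. *)
exists a, (Num.max m (expR (expR (expR 1)))); split => //.
  by rewrite le_max -[X in X <= expR _]expR0 ler_expR expR_ge0 orbT.
move=> t; rewrite gt_max => /andP[mt et].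
have lt1 (x y : R) : expR x < y -> x < ln y.
  move=> xy; rewrite -[X in X < _]expRK ltr_ln ?posrE ?expR_gt0//.
  by rewrite (lt_trans (expR_gt0 x)).
have l1 : 1 < ln (ln (ln t)) by exact: (lt1 _ _ (lt1 _ _ (lt1 _ _ et))).
split=> //; have := aV t (mV t mt).
by rewrite ler_pdivlMr// (lt_trans ltr01).
Qed.

(** For [u > t0], [eps r(u) <= t] gives [a ln ln ln u <= ln (t / eps)]; exponentiating twice yields
    [ln u <= exp ((t / eps)^(1/a))], so [b = 1/a < 1]. The factor [A = 1 + ln t0] absorbs the range
    [u <= t0]. *)
Lemma growth_log_bound (r : R -> R) (eps : R) : 0 < eps ->
  (forall t, 1 <= t -> 0 < r t) ->
  (1 < limf_einf (fun t : R => (ln (r t) / ln (ln (ln t)))%:E) (pinfty_nbhs R))%E ->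
  exists A M b : R, [/\ 1 <= A, 0 <= M, 0 < b < 1 &
    forall u t, 1 <= u -> 1 <= t -> eps * r u <= t -> ln u <= A * expR (M * t `^ b)].
Proof.
move=> eps0 r_pos /growth_exponent[a [t0 [a1 t01 H]]].
have a0 : 0 < a := lt_trans ltr01 a1.
exists (1 + ln t0), (eps^-1 `^ a^-1), a^-1.
have e1 (x : R) : 0 <= x -> 1 <= expR x by move=> x0; rewrite -expR0 ler_expR.
split.
- by rewrite lerDl ln_ge0.
- exact: powR_ge0.
- by rewrite invr_gt0 a0 invf_lt1.
move=> u t u1 t1 rt.
have t00 := lt_le_trans ltr01 t1.
rewrite -powRM ?invr_ge0 ?(ltW eps0) ?(ltW t00)//.
have lt0 : 0 <= ln t0 by exact: ln_ge0.
have eM : 1 <= expR ((eps^-1 * t) `^ a^-1) by rewrite e1// powR_ge0.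
have [ut0|t0u] := leP u t0.
  have : ln u <= ln t0 by rewrite ler_ln// posrE (lt_le_trans ltr01).
  by nra.
have [l1 l2] := H _ t0u.
have lu0 : 0 < ln (ln u).
  by rewrite ltNge; apply/negP => /ln0 h; move: l1; rewrite h ltr10.
have lu1 : 0 < ln u.
  by rewrite ltNge; apply/negP => /ln0 h; move: lu0; rewrite h ltxx.
suff : ln u <= expR ((eps^-1 * t) `^ a^-1) by nra.
rewrite -{1}(lnK lu1) ler_expR -{1}(lnK lu0).
have et0 : 0 < eps^-1 * t by rewrite mulr_gt0// invr_gt0.
rewrite /powR gt_eqF// ler_expR -(ler_pM2l a0) mulrA divff ?gt_eqF// mul1r.
apply: (le_trans l2); rewrite ler_ln ?posrE ?r_pos//.
by rewrite ler_pdivlMl.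
Qed.

End Growth.

(** * Scaling of cube maps *)

Section CubeMaps.
Variables (R : realType) (d : nat).
Implicit Types (D : 'M[R]_d) (L t : R).

Lemma cube_map_scale L t D : 0 < t -> cube_map L D -> cube_map (t * L) (t *: D).
Proof.
move=> t0 [Du L0 H]; have tu : t \is a GRing.unit by rewrite unitfE gt_eqF.
split; [by rewrite unitmxZ|exact: mulr_gt0|move=> v].
rewrite invmxZ ?unitmxZ// -scalemxAl normrZ gtr0_norm ?invr_gt0// H.
by rewrite invfM mulrCA.
Qed.

Lemma cube_map_scalar L : 0 < L -> cube_map L (L%:M : 'M[R]_d).
Proof.
move=> L0; rewrite -scalemx1 -{1}[L]mulr1; apply: cube_map_scale => //.
by split=> [|//|v]; rewrite ?unitmx1// invmx1 mul1mx divr1.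
Qed.

Lemma cube_map_tile_setP L D c x : cube_map L D ->
  tile_set (D, c) x <-> `|x - c| <= L / 2.
Proof.
by case=> _ L0 H; rewrite /tile_set /= H ler_pdivrMr// mulrC.
Qed.

End CubeMaps.

(** * Dilated boxes *)

Section DilatedTiling.
Variables (R : realType) (d : nat) (r : R -> R) (Bs : set (box R d)).
Hypothesis r_pos : forall t, 1 <= t -> 0 < r t.
Hypothesis r_incr : nondecreasing_from1 r.
Hypothesis Bs_tiling : tiled_by Bs.
Hypothesis Bs_side : forall B, Bs B -> 1 <= box_side B.
Hypothesis Bs_slow : slowly_varying r Bs.

Local Notation eta := (reach d r).
Local Notation N := (chain_bound d).
Local Notation c := (eta ^+ 2).

Let eta_gt0 : 0 < eta := reach_gt0 d r_pos.
Let eta_le1 : eta <= 1 := reach_le1 d r_pos.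

Lemma chain_bound_gt0 : (0 < N)%N.
Proof.
by apply/card_gt0P; exists [ffun=> Ordinal (isT : (0 < 4 * 1 + 4)%N)].
Qed.

(** The point of [B] nearest to [z] is within [c] times the side of [B], and [c <= eta], so the
    local comparison applies from that point. *)
Lemma dilate_ratio B B' z : Bs B -> box_set (box_dilate (1 + 2 * c) B) z ->
  Bs B' -> box_set B' z ->
  eta * box_side B' <= box_side B /\ eta * box_side B <= box_side B'.
Proof.
move=> hB Bz hB' B'z.
have B0 := ltW (tiling_side_gt0 Bs_side hB).
apply: (local_ratio_reach r_pos r_incr Bs_tiling Bs_side Bs_slow hB
  (box_clamp_in z B0)).
split=> //; exists z => //; apply: (le_trans (box_clamp_dist B0 (sqr_ge0 _) Bz)).
by rewrite ler_wpM2r// expr2 ler_piMl// ltW.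
Qed.

(** The boxes whose dilates contain [xi] are comparable with a box [B0] containing [xi], so one grid
    adapted to [B0] codes them all. *)
Lemma dilate_code xi : exists g : box R d -> {ffun 'I_d -> 'I_(4 * 1 + 4)},
  forall B B', Bs B -> Bs B' ->
    box_set (box_dilate (1 + 2 * c) B) xi ->
    box_set (box_dilate (1 + 2 * c) B') xi -> g B = g B' -> B = B'.
Proof.
have [B0 h0 B0xi] := tiling_cover Bs_tiling xi.
have B00 := tiling_side_gt0 Bs_side h0.
have [g gP] := @grid_code _ _ _ Bs_tiling (eta * box_side B0) 1 xi (mulr_gt0 eta_gt0 B00).
have near B : Bs B -> box_set (box_dilate (1 + 2 * c) B) xi ->
    boxes_near Bs xi (1%:R * (eta * box_side B0)) B /\ eta * box_side B0 <= box_side B.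
  move=> hB Bxi; have [H1 H2] := dilate_ratio hB Bxi h0 B0xi.
  have BB0 := ltW (tiling_side_gt0 Bs_side hB).
  split=> //; split=> //; exists (box_clamp B xi); first exact: box_clamp_in.
  rewrite distrC (le_trans (box_clamp_dist BB0 (sqr_ge0 _) Bxi))// mul1r.
  (* This is why [c] is a square: one factor [eta] passes from the side of [B] to that of [B0], the
     other gives the radius of the grid. *)
  by rewrite expr2 -mulrA ler_pM2l.
exists g => B B' hB hB' Bxi B'xi.
by have [? ?] := near B hB Bxi; have [? ?] := near B' hB' B'xi; exact: gP.
Qed.

(** Chosen so that the step count [4 rho / eta] in [radius_ratio] meets the bound of [far_ratio]
    exactly: [(4 rho / eta) N = r / 2]. *)
Definition radius_slope : R := eta / (8 * N%:R).

(* The function rho of the regularity condition. *)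
Definition radius (B : box R d) : R :=
  Num.max 1 (radius_slope * r (Num.max 1 (eta * box_side B / 2))).

Lemma radius_slope_gt0 : 0 < radius_slope.
Proof. by rewrite divr_gt0// mulr_gt0// ltr0n chain_bound_gt0. Qed.

(** Compare through a box [B3] containing [z]: with [B2] by [dilate_ratio], and with [B1] by
    [far_ratio], or again by [dilate_ratio] when the radius is the default 1. *)
Lemma radius_ratio B1 B2 z : Bs B1 -> Bs B2 ->
  box_set (box_dilate (1 + 2 * c) B2) z ->
  `|z - box_center B1| <= radius B1 * ((1 + 2 * c) * box_side B1) / 2 ->
  box_side B1 <= 2 / eta ^+ 2 * box_side B2 /\
  box_side B2 <= 2 / eta ^+ 2 * box_side B1.
Proof.
move=> h1 h2 B2z zB1.
have [B3 h3 B3z] := tiling_cover Bs_tiling z.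
have [H32 H23] := dilate_ratio h2 B2z h3 B3z.
have B10 := tiling_side_gt0 Bs_side h1.
have B20 := tiling_side_gt0 Bs_side h2.
have c0 : 0 <= c by exact: sqr_ge0.
have c1 : c <= 1 by rewrite exprn_ile1// ltW.
suff [H1 H2] : eta * box_side B1 <= 2 * box_side B3 /\
    eta * box_side B3 <= 2 * box_side B1.
  rewrite ![_ / eta ^+ 2 * _]mulrAC !ler_pdivlMr ?(exprn_gt0 2 eta_gt0)//.
  by have := eta_gt0; split; nra.
move: zB1; rewrite /radius; case: (leP 1 (radius_slope * _)) => [rho1|_].
  rewrite -mulrA => zB1.
  (* As [1 + 2 c <= 3], [z] is within [3 rho] half-sides of the center of [B1], and one step covers
     [eta] half-sides. *)
  set n := Num.truncn (3 * (radius_slope * r (Num.max 1 (eta * box_side B1 / 2))) / eta).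
  move: rho1 zB1 @n; set u := Num.max 1 _; set rho := radius_slope * r u => rho1 zB1 n.
  have q0 : 0 <= 3 * rho / eta.
    by rewrite divr_ge0 ?(ltW eta_gt0)// mulr_ge0// (le_trans ler01).
  have /andP[n1 n2] := truncn_itv q0; rewrite -/n in n1 n2.
  have n2' : 3 * rho < n.+1%:R * eta by rewrite -ltr_pdivrMr.
  have n1' : n.+1%:R <= 4 * rho / eta.
    rewrite -natr1; apply: (@le_trans _ _ (3 * rho / eta + rho / eta)).
      by rewrite lerD// ler_pdivlMr// mul1r (le_trans eta_le1).
    by rewrite -mulrDl; have -> : 3 * rho + rho = 4 * rho by ring.
  have [||H1 H2] := far_ratio r_pos r_incr Bs_tiling Bs_side Bs_slow h1
    (box_center_in (ltW B10)) (n := n) h3 B3z.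
  - apply: (le_trans zB1).
    apply: (@le_trans _ _ (3 * rho * (box_side B1 / 2))).
      have : 0 <= rho * box_side B1 by rewrite mulr_ge0 ?(ltW B10)// (le_trans ler01).
      by nra.
    have -> : n.+1%:R * (eta * box_side B1 / 2) = n.+1%:R * eta * (box_side B1 / 2).
      by rewrite !mulrA.
    by rewrite ler_wpM2r ?divr_ge0 ?(ltW B10)// ltW.
  - apply: (@le_trans _ _ (4 * rho / eta * N%:R)); first by rewrite ler_wpM2r.
    rewrite le_eqVlt; apply/orP; left; apply/eqP.
    rewrite /rho /radius_slope; field.
    by rewrite gt_eqF// pnatr_eq0 -lt0n chain_bound_gt0.
  - have e1 := eta_le1; have e0 := eta_gt0; have B30 := tiling_side_gt0 Bs_side h3.
    by split; nra.
rewrite mul1r => zB1.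
have B1z : box_set (box_dilate (1 + 2 * c) B1) z.
  by apply/box_setP => //=; rewrite mulr_ge0 ?(ltW B10)// addr_ge0// mulr_ge0.
have [H1 H2] := dilate_ratio h1 B1z h3 B3z.
have B30 := tiling_side_gt0 Bs_side h3.
by split; [apply: (le_trans H2)|apply: (le_trans H1)]; rewrite ler_peMl ?ler1n// ltW.
Qed.

End DilatedTiling.

(** * Verification of the admissibility conditions *)

Lemma almost_everyT (R : realType) (d : nat) (P : 'cV[R]_d -> Prop) :
  (0 < d)%N -> (forall x, P x) -> almost_every P.
Proof.
case: d P => // d P _ HP; rewrite /almost_every.
have -> : [set x | ~ P x] = set0.
  by apply/seteqP; split => // x; apply.
apply/eqP; rewrite eq_le; apply/andP; split.
  (* Degenerate boxes have volume 0 because [d > 0] gives the product a zero factor. *)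
  apply: ereal_inf_lbound; exists (fun _ => 0), (fun _ => 0); split => //.
  rewrite eseries0// => i _ _.
  by rewrite big_ord_recl !mxE subr0 mul0r.
apply: le_ereal_inf_tmp => _ [a [b [ab _ ->]]].
apply: nneseries_ge0 => k _ _.
by rewrite lee_fin prodr_ge0// => i _; rewrite subr_ge0.
Qed.

Lemma exp_powR_admissible (R : realType) (C theta A M b : R) :
  1 < C -> 0 < theta < 1 -> 1 <= A -> 0 <= M -> 0 < b < 1 ->
  admissible_parameters C theta (fun t => A * expR (M * t `^ b)).
Proof.
move=> C1 th A1 M0 /andP[b0 b1].
have A0 : 0 < A by exact: lt_le_trans A1.
split=> //.
- move=> x y; rewrite !in_itv /= !andbT => x1 y1 xy.
  rewrite ler_pM2l// ler_expR ler_wpM2l// ge0_ler_powR ?nnegrE ?(ltW b0)//;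
    exact: le_trans ler01 _.
- rewrite -[leLHS]mulr1 ler_pM// -expR0 ler_expR.
  by rewrite mulr_ge0 ?powR_ge0.
- rewrite [ltLHS](_ : _ = \int[lebesgue_measure]_(t in `[1%R, +oo[)
     ((ln A + M * t `^ b) / t ^+ 2)%:E)%E.
    by apply: integral_powR_lty => //; exact: ln_ge0.
  by apply: eq_integral => t _; rewrite lnM ?posrE ?expR_gt0// expRK.
Qed.

(* Several tiles may have the same tile set: their matrices then differ by a
   signed permutation, and this code separates them. *)
Definition cube_code (R : realType) (d : nat) (L : R) (D : 'M[R]_d) :
    'M[bool * bool]_d :=
  \matrix_(i, j) (D i j == L, D i j == - L).

Lemma cube_code_inj (R : realType) (d : nat) (L : R) (D D' : 'M[R]_d) :
  cube_map L D -> cube_map L D' -> cube_code L D = cube_code L D' -> D = D'.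
Proof.
move=> h h' /matrixP HD; apply/matrixP => i j; have [_ L0 _] := h.
have := HD i j; rewrite !mxE.
have LN : (L == - L) = false.
  by apply/negP => /eqP LL; lra.
have L00 : (0 == L) = false by rewrite eq_sym gt_eqF.
have NL00 : (0 == - L) = false by rewrite eq_sym oppr_eq0 gt_eqF.
by case: (cube_map_entry i j h) => ->; case: (cube_map_entry i j h') => ->;
   rewrite ?eqxx ?LN ?L00 ?NL00 ?[- L == L]eq_sym ?LN.
Qed.

(** The centers are the cubes of side [k 2^i] with [i < n]. A cube of side [k l] with
    [2^i <= l <= 2^(i+1)] is at distance at most 1 from one of them, and [1 < C]. *)
Lemma cube_sides_covered (R : realType) (d : nat) (k C lmax : R) (n : nat)
    (S : set 'M[R]_d) : 0 < k -> 1 < C -> lmax / ln 2 + 1 <= n%:R ->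
  (forall D, S D -> exists l, [/\ 1 <= l, ln l <= lmax & cube_map (k * l) D]) ->
  covered_by_balls n C [set tile_set (D, 0) | D in S].
Proof.
move=> k0 C1 lmaxn HS.
have ln20 : 0 < ln 2 :> R by rewrite ln_gt0// ltr1n.
have cm (i : 'I_n) : cube_map (k * 2 ^+ i) ((k * 2 ^+ i)%:M : 'M[R]_d).
  by apply: cube_map_scalar; rewrite mulr_gt0// exprn_gt0.
exists (fun i => (k * 2 ^+ i)%:M); split; first by move=> i; case: (cm i).
move=> _ [D /HS[l [l1 llm hD]] <-].
have l0 : 0 < l by exact: lt_le_trans l1.
have q0 : 0 <= ln l / ln 2 by rewrite divr_ge0 ?(ltW ln20)// ln_ge0.
have /andP[] := truncn_itv q0; set i := Num.truncn _ => i1 i2.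
have iln : (i < n)%N.
  rewrite -(ltr_nat R); apply: lt_le_trans lmaxn; apply: (le_lt_trans i1).
  by rewrite ltr_pwDr// ler_pM2r// invr_gt0.
exists (Ordinal iln) => //; exists D => //; split; first by case: hD.
have pl : (2 : R) ^+ i <= l.
  rewrite -ler_ln ?posrE ?exprn_gt0// lnXn// -[leLHS]mulr_natl.
  by rewrite -ler_pdivlMr.
have lp : l <= 2 * 2 ^+ i.
  rewrite -exprS -ler_ln ?posrE ?exprn_gt0// lnXn// -[leRHS]mulr_natl.
  by rewrite -ler_pdivrMr// ltW.
have h1 : k * l <= 2 * (k * 2 ^+ i) by rewrite mulrCA ler_pM2l.
have h2 : k * 2 ^+ i <= 2 * (k * l).
  by rewrite mulrCA ler_pM2l// (le_trans pl)// ler_peMl ?(ltW l0)// ler1n.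
have := cube_map_dist 0 0 (cm (Ordinal iln)) hD (ler1n _ 2) h1 h2.
by rewrite divff ?gt_eqF// => /le_lt_trans; apply.
Qed.

Theorem proposition1 (R : realType) (d : nat) (hd : (1 <= d)%N) (r : R -> R)
    (r_pos : forall t, 1 <= t -> 0 < r t)
    (r_incr : nondecreasing_from1 r)
    (r_growth :
       (1 < limf_einf (fun t : R => (ln (r t) / ln (ln (ln t)))%:E)
                      (pinfty_nbhs R))%E) :
  exists2 c : R, 0 < c &
  exists (C theta : R) (K : R -> R),
    admissible_parameters C theta K /\
    forall Bs : set (box R d),
      tiled_by Bs ->
      (forall B, Bs B -> 1 <= box_side B) ->
      slowly_varying r Bs ->
      forall Ts : set (tile R d),
        (forall T, Ts T -> is_tile T) ->
        [set tile_set T | T in Ts] =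
          [set box_set (box_dilate (1 + 2 * c) B) | B in Bs] ->
        admissible_tiling C theta K Ts.
Proof.
pose eta := reach d r; pose c := eta ^+ 2; pose k := 1 + 2 * c.
have eta0 : 0 < eta := reach_gt0 d r_pos.
have eta1 : eta <= 1 := reach_le1 d r_pos.
have c0 : 0 < c by exact: exprn_gt0.
have k1 : 1 < k by rewrite /k; lra.
have k0 : 0 < k by exact: lt_trans k1.
have ln20 : 0 < ln 2 :> R by rewrite ln_gt0// ltr1n.
have [A [M [b [A1 M0 b01 lnA]]]] :=
  growth_log_bound (radius_slope_gt0 d r_pos) r_pos r_growth.
have e21 : 1 <= 2 / eta by rewrite ler_pdivlMr// mul1r; lra.
have ln_eta : 0 <= ln (2 / eta) by exact: ln_ge0.
(* Counts the dyadic scales of the sides; of the extra 2, one is required by [cube_sides_covered]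
   and one pays for truncating [K t]. *)
pose A' := (ln (2 / eta) + A) / ln 2 + 2.
(* Codes of the tiles through a point: one part for the box, one for the matrix. *)
pose X : finType := ({ffun 'I_d -> 'I_(4 * 1 + 4)} * 'M[bool * bool]_d)%type.
pose ratio := 2 / eta ^+ 2.
have ratio1 : 1 <= ratio.
  rewrite /ratio ler_pdivlMr ?(exprn_gt0 2 eta0)// mul1r.
  by apply: (@le_trans _ _ 1); rewrite ?ler1n// exprn_ile1// ltW.
(* Room for both the multiplicity and the distance bound; the 2 ensures [C > 1]. *)
pose C := 2 + #|X|%:R + ln ratio / ln 2.
have lnr0 : 0 <= ln ratio / ln 2 by rewrite divr_ge0 ?(ltW ln20)// ln_ge0.
have X0 : 0 <= #|X|%:R :> R by [].
have C1 : 1 < C by rewrite /C; lra.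
(* With [theta = 1 - 1/k], the factor [1 - theta] shrinks the dilate of a box exactly back to the
   box. *)
exists c => //; exists C, (1 - k^-1), (fun t => A' * expR (M * t `^ b)); split.
  apply: exp_powR_admissible => //.
    by rewrite subr_gt0 invf_lt1// k1 gtrBl invr_gt0.
  have : 0 <= (ln (2 / eta) + A) / ln 2.
    by rewrite divr_ge0 ?(ltW ln20)// addr_ge0// (le_trans ler01).
  by rewrite /A'; lra.
move=> Bs Bs_tiling Bs_side Bs_slow Ts Ts_tile TsBs.
have /choice[bx bxP] : forall T, exists B, Ts T ->
    Bs B /\ tile_set T = box_set (box_dilate k B).
  move=> T; have [hT|nT] := pselect (Ts T); last by exists (Box 0 0) => hT; case: nT.
  have : [set tile_set T | T in Ts] (tile_set T) by exists T.
  by rewrite TsBs => -[B hB BT]; exists B.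
have bxT T : Ts T -> [/\ Bs (bx T), T.2 = box_center (bx T) &
    cube_map (k * box_side (bx T)) T.1].
  move=> hT; have [hB TB] := bxP T hT; have B0 := tiling_side_gt0 Bs_side hB.
  have [] := @tile_set_box _ _ T (box_dilate k (bx T)) (Ts_tile _ hT) _ TB.
    exact: mulr_gt0.
  by move=> ? ?; split.
split=> //.
- apply: almost_everyT => // xi; split.
    have [B hB Bxi] := tiling_cover Bs_tiling xi.
    have B0 := tiling_side_gt0 Bs_side hB.
    have : [set box_set (box_dilate k B) | B in Bs] (box_set (box_dilate k B)).
      by exists B.
    rewrite -TsBs => -[T hT TB]; exists T => //.
    have [T2 Tc] := @tile_set_box _ _ T (box_dilate k B)
      (Ts_tile _ hT) (mulr_gt0 k0 B0) TB.
    have kV : 1 - (1 - k^-1) = k^-1 by rewrite opprB addrCA subrr addr0.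
    apply/(cube_map_tile_setP T.2 xi (cube_map_scale _ Tc)); rewrite kV ?invr_gt0//.
    by rewrite mulKf ?gt_eqF// T2 /=; exact/(box_setP _ (ltW B0)).
  exists #|X|; first by rewrite /C; lra.
  have [g gP] := dilate_code r_pos r_incr Bs_tiling Bs_side Bs_slow xi.
  apply: (@inj_finType_card_le _ X _
    (fun T => (g (bx T), cube_code (k * box_side (bx T)) T.1))).
  move=> T T' [hT Txi] [hT' T'xi] [gTT' codeTT'].
  have [hB T2 Tc] := bxT T hT; have [hB' T2' Tc'] := bxT T' hT'.
  have BB' : bx T = bx T'.
    apply: gP => //.
      by rewrite -(bxP T hT).2.
    by rewrite -(bxP T' hT').2.
  rewrite (surjective_pairing T) (surjective_pairing T'); congr (_, _).
    by apply: (cube_code_inj Tc); [rewrite BB'|rewrite codeTT' BB'].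
  by rewrite T2 T2' BB'.
- exists (fun T => radius r (bx T)); split.
  + by move=> T _; rewrite /radius le_max lexx.
  + move=> T1 T2 hT1 hT2 [z [T2z T1z]].
    have [h1 c1 m1] := bxT T1 hT1; have [h2 c2 m2] := bxT T2 hT2.
    rewrite (bxP T2 hT2).2 in T2z.
    have rad0 : 0 < radius r (bx T1) by rewrite /radius lt_max ltr01.
    move: T1z => /(cube_map_tile_setP T1.2 z (cube_map_scale rad0 m1)); rewrite c1 => T1z.
    have [H1 H2] := radius_ratio r_pos r_incr Bs_tiling Bs_side Bs_slow h1 h2 T2z T1z.
    apply: (@le_trans _ _ (ln ratio / ln 2)); last by rewrite /C; lra.
    by apply: (cube_map_dist 0 0 m1 m2) => //; rewrite mulrCA ler_pM2l.
  + move=> t t1; pose e := expR (M * t `^ b).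
    have e1 : 1 <= e by rewrite -[leLHS]expR0 ler_expR mulr_ge0 ?powR_ge0.
    have K0 : 0 <= A' * e.
      rewrite mulr_ge0 ?(le_trans ler01 e1)// addr_ge0// divr_ge0 ?(ltW ln20)//.
      by rewrite addr_ge0// (le_trans ler01).
    exists (Num.truncn (A' * e)); first by rewrite truncn_le.
    have := @cube_sides_covered R d k C (ln (2 / eta) + A * e) (Num.truncn (A' * e))
      [set T.1 | T in [set T | Ts T /\ radius r (bx T) <= t]] k0 C1.
    rewrite image_comp; apply.
    * have /andP[_ /ltW] := truncn_itv K0; rewrite -natr1 => trA.
      have : (ln (2 / eta) + A * e) / ln 2 + 2 <= A' * e.
        rewrite /A' [leRHS]mulrDl lerD//; last by rewrite ler_peMr.
        rewrite [leRHS]mulrAC ler_wpM2r ?invr_ge0 ?(ltW ln20)// [leRHS]mulrDl lerD2r.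
        by rewrite ler_peMr.
      by lra.
    * move=> _ [T [hT Tt] <-]; have [hB _ mT] := bxT T hT.
      exists (box_side (bx T)); split=> //; first exact: Bs_side.
      have B0 := tiling_side_gt0 Bs_side hB.
      have : ln (Num.max 1 (eta * box_side (bx T) / 2)) <= A * e.
        apply: lnA => //; first by rewrite le_max lexx.
        by apply: le_trans Tt; rewrite /radius le_max lexx orbT.
      (* The side is recovered from the argument of [r] in [radius], which costs the term
         [ln (2 / eta)]. *)
      have H : box_side (bx T) = 2 / eta * (eta * box_side (bx T) / 2).
        by field; rewrite gt_eqF.
      have u0 : 0 < eta * box_side (bx T) / 2 by rewrite divr_gt0// mulr_gt0.
      rewrite {2}H lnM ?posrE ?u0 ?divr_gt0// => H2; rewrite lerD2l; apply: le_trans H2.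
      by rewrite ler_ln ?posrE// ?lt_max ?ltr01// le_max lexx orbT.
Qed.
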